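(* Let $D_\infty=\mathbb{Z}\rtimes\mathbb{Z}/2\mathbb{Z}=\langle s,t\mid t^2,\ tsts\rangle$ be the infinite dihedral group, and let $\alpha$ and $\beta$ be two minimal continuous actions of $D_\infty$ on an infinite compact Hausdorff space $X$. If $\alpha$ and $\beta$ are continuously orbit equivalent, then they are conjugate.
   Context: Continuous orbit equivalence: two continuous actions $G\curvearrowright X$ and $K\curvearrowright Y$ on compact Hausdorff spaces are continuously orbit equivalent if there is a homeomorphism $\phi:X\to Y$ with inverse $\psi$ and continuous maps $a:G\times X\to K$, $b:K\times Y\to G$ such that $\phi(gx)=a(g,x)\phi(x)$ and $\psi(hy)=b(h,y)\psi(y)$ for all $g\in G$, $h\in K$, $x\in X$, $y\in Y$. Two actions $\alpha,\beta$ of the same group $G$ on $X$ are conjugate if there are a homeomorphism $\phi:X\to X$ and a group automorphism $\tau$ of $G$ with $\phi(\alpha_g x)=\beta_{\tau(g)}(\phi(x))$ for all $g\in G$, $x\in X$. *)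

(* Defs.v *)
From HB Require Import structures.
From mathcomp Require Import all_boot all_order all_algebra.
From mathcomp Require Import all_classical topology.
Set Implicit Arguments.
Unset Strict Implicit.
Unset Printing Implicit Defensive.
Import GRing.Theory Num.Theory.
Local Open Scope classical_set_scope.
Local Open Scope ring_scope.

(* The infinite dihedral group D_oo = Z >| Z/2, elements (n, e) stand for s^n t^e,
   with s = (1,false), t = (0,true); t^2 = 1 and tsts = 1. *)
Definition Dinf : Type := (int * bool)%type.
Definition Dmul (g h : Dinf) : Dinf :=
  (g.1 + (if g.2 then - h.1 else h.1), xorb g.2 h.2).
Definition Done : Dinf := (0, false).
Definition Dinv (g : Dinf) : Dinf := (if g.2 then g.1 else - g.1, g.2).
Definition Ds : Dinf := (1, false).
Definition Dt : Dinf := (0, true).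

Definition is_Dinf_aut (tau : Dinf -> Dinf) : Prop :=
  bijective tau /\ forall g h, tau (Dmul g h) = Dmul (tau g) (tau h).

Definition is_Dinf_action (X : topologicalType) (alpha : Dinf -> X -> X) : Prop :=
  (forall x, alpha Done x = x) /\
  (forall g h x, alpha (Dmul g h) x = alpha g (alpha h x)) /\
  (forall g, continuous (alpha g)).

Definition minimal_action (X : topologicalType) (alpha : Dinf -> X -> X) : Prop :=
  forall A : set X, closed A -> A !=set0 ->
    (forall g x, A x -> A (alpha g x)) -> A = setT.

Definition continuous_to_discrete (X : topologicalType) (c : X -> Dinf) : Prop :=
  forall x, \forall y \near x, c y = c x.

(* Continuity of a : D_oo x X -> D_oo, D_oo discrete. *)
Definition continuous_cocycle (X : topologicalType) (a : Dinf -> X -> Dinf) : Prop :=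
  forall g, continuous_to_discrete (a g).

Definition homeomorphism (X : topologicalType) (phi psi : X -> X) : Prop :=
  continuous phi /\ continuous psi /\ cancel phi psi /\ cancel psi phi.

Definition cont_orbit_equivalent (X : topologicalType) (alpha beta : Dinf -> X -> X) : Prop :=
  exists (phi psi : X -> X) (a b : Dinf -> X -> Dinf),
    homeomorphism phi psi /\ continuous_cocycle a /\ continuous_cocycle b /\
    (forall g x, phi (alpha g x) = beta (a g x) (phi x)) /\
    (forall h y, psi (beta h y) = alpha (b h y) (psi y)).

Definition conjugate_actions (X : topologicalType) (alpha beta : Dinf -> X -> X) : Prop :=
  exists (phi psi : X -> X) (tau : Dinf -> Dinf),
    homeomorphism phi psi /\ is_Dinf_aut tau /\
    (forall g x, phi (alpha g x) = beta (tau g) (phi x)).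

(* Main.v *)
Require Import Defs.
From mathcomp Require Import all_boot all_order all_algebra.
From mathcomp Require Import all_classical topology.
From mathcomp Require Import zify.
Import Order.TTheory GRing.Theory Num.Theory.
Local Open Scope classical_set_scope.
Local Open Scope ring_scope.

(* A minimal action of D_oo on an infinite compact Hausdorff space is topologically
   free, so an orbit equivalence has a genuine cocycle [a], and each [a _ x] is a
   bijection of D_oo.  The Cayley graph of D_oo for the two reflections t and st is
   a line, on which right multiplications act by isometries; there [a _ x] becomes
   a bi-Lipschitz bijection f_x of the integers.  The preimage under f_x of the
   negative half-line differs from some half-line by finitely many points, and
   counting these points singles out one isometry c(x) of the line such that f_x and
   c(x) pull the negative half-line back to sets with equal "index".  The map c is
   locally constant and equivariant.  Isometries of the line form a group containing
   D_oo with index two, and minimality makes the class of c(x) constant, so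
   c(x) = d(x) eta with d(x) in D_oo and eta fixed.  Equivariance then reads
   a(h, x) = d(hx) tau(h) d(x)^-1, where tau is conjugation by eta, and
   x |-> d(x)^-1 phi(x) is the required conjugacy. *)

(** * Group laws of $D_\infty$ and isometries of the integer line *)

Lemma DmulA f g h : Dmul f (Dmul g h) = Dmul (Dmul f g) h.
Proof.
by case: f g h => [n [|]] [m [|]] [k [|]]; rewrite /Dmul /=; congr pair; lia.
Qed.

Lemma Dmul1g g : Dmul Done g = g.
Proof. by case: g => [n e]; rewrite /Dmul /= add0r; case: e. Qed.

Lemma Dmulg1 g : Dmul g Done = g.
Proof. by case: g => [n [|]]; rewrite /Dmul /=; congr pair; lia. Qed.

Lemma DmulVg g : Dmul (Dinv g) g = Done.
Proof. by case: g => [n [|]]; rewrite /Dmul /Done /=; congr pair; lia. Qed.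

Lemma DmulgV g : Dmul g (Dinv g) = Done.
Proof. by case: g => [n [|]]; rewrite /Dmul /Done /=; congr pair; lia. Qed.

Lemma DmulK g h : Dmul (Dmul h g) (Dinv g) = h.
Proof. by rewrite -DmulA DmulgV Dmulg1. Qed.

Lemma Dmul_injr f g h : Dmul f g = Dmul h g -> f = h.
Proof. by move=> /(congr1 (fun u => Dmul u (Dinv g))); rewrite !DmulK. Qed.

Lemma DmulVK g h : Dmul (Dmul h (Dinv g)) g = h.
Proof. by rewrite -DmulA DmulVg Dmulg1. Qed.

Lemma DmulKV g h : Dmul (Dinv g) (Dmul g h) = h.
Proof. by rewrite DmulA DmulVg Dmul1g. Qed.

(* [Dinf] doubles as the isometry group of the integer line. *)
Definition line_isom (w : Dinf) (i : int) : int := w.1 + (if w.2 then - i else i).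

Lemma line_isomM v w i : line_isom (Dmul v w) i = line_isom v (line_isom w i).
Proof. by case: v w => [n [|]] [m [|]]; rewrite /line_isom /=; lia. Qed.

Lemma line_isom1 i : line_isom Done i = i.
Proof. by rewrite /line_isom add0r. Qed.

Lemma line_isomK v : cancel (line_isom v) (line_isom (Dinv v)).
Proof. by move=> i; rewrite -line_isomM DmulVg line_isom1. Qed.

Lemma line_isomKV v : cancel (line_isom (Dinv v)) (line_isom v).
Proof. by move=> i; rewrite -line_isomM DmulgV line_isom1. Qed.

(** * Counting points in symmetric windows *)

(* The number of points of [A] in the window [-N, N). *)
Definition window_count (A : int -> bool) (N : nat) : int :=
  \sum_(i < N) ((A i)%:Z + (A (- 1 - i%:Z))%:Z).

Lemma window_countS A N :
  window_count A N.+1 = window_count A N + ((A N)%:Z + (A (- 1 - N%:Z))%:Z).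
Proof. by rewrite /window_count big_ord_recr. Qed.

Lemma window_count0 A : window_count A 0 = 0.
Proof. by rewrite /window_count big_ord0. Qed.

Lemma eq_window_count A B N : A =1 B -> window_count A N = window_count B N.
Proof. by move=> AB; apply: eq_bigr => i _; rewrite !AB. Qed.

(** Moving the window $[-N,N)$ one step to the right gains the point [N] and loses [- N]. *)
Lemma window_count_shift A N :
  window_count (fun i => A (1 + i)) N =
  window_count A N + (A N)%:Z - (A (- N%:Z))%:Z.
Proof.
elim: N => [|N IH]; first by rewrite !window_count0 oppr0 add0r subrr.
rewrite !window_countS IH.
have -> : 1 + N%:Z = N.+1 by lia.
have -> : 1 + (- 1 - N%:Z) = - N%:Z by lia.
have -> : - N.+1%:Z = - 1 - N%:Z by lia.
lia.
Qed.

(** The window is centred at $-1/2$, so $i\mapsto -1-i$ preserves it. *)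
Lemma window_count_flip A N :
  window_count (fun i => A (- 1 - i)) N = window_count A N.
Proof.
apply: eq_bigr => i _; have -> : - 1 - (- 1 - i%:Z) = i by lia.
by rewrite addrC.
Qed.

Lemma window_count_neg A N :
  window_count (fun i => ~~ A i) N = N%:Z + N%:Z - window_count A N.
Proof.
elim: N => [|N IH]; first by rewrite !window_count0.
by rewrite !window_countS IH; case: (A N); case: (A _) => /=; lia.
Qed.

Lemma window_count_pred1 k N : (`|k| < N)%N ->
  window_count (fun i => i == k) N = 1.
Proof.
have H M : window_count (fun i => i == k) M =
   ((k < M%:Z) && (- M%:Z <= k))%:Z.
  elim: M => [|M IH]; first by rewrite window_count0; lia.
  by rewrite window_countS IH; lia.
by rewrite H; lia.
Qed.

Lemma window_count_halfline (q : int) N : (`|q| <= N)%N ->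
  window_count (fun i => i < q) N = N%:Z + q.
Proof.
have H M : window_count (fun i => i < q) M =
   if q < - M%:Z then 0 else if M%:Z < q then M%:Z + M%:Z else M%:Z + q.
  elim: M => [|M IH]; first by rewrite window_count0; do 2?case: ifP => ?; lia.
  by rewrite window_countS IH; do !case: ifP => ?; lia.
by rewrite H; do 2?case: ifP => ?; lia.
Qed.

Lemma window_count_disjointU A k N : ~~ A k -> (`|k| < N)%N ->
  window_count (fun i => A i || (i == k)) N = window_count A N + 1.
Proof.
move=> Ak kN; rewrite -(window_count_pred1 k N kN) /window_count -big_split /=.
have H i : (A i || (i == k))%:Z = (A i)%:Z + (i == k)%:Z.
  by case: eqP => [->|_]; rewrite ?(negPf Ak)// orbF addr0.
by apply: eq_bigr => i _; rewrite !H addrACA.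
Qed.

Lemma window_count_bounds A N :
  (0 <= window_count A N) && (window_count A N <= N%:Z + N%:Z).
Proof.
elim: N => [|N IH]; first by rewrite !window_count0.
by rewrite !window_countS; lia.
Qed.

(** * Balanced sets of integers and the half-lines they determine *)

(* The symmetric difference is finite and its two halves have the same size. *)
Definition balanced (A B : int -> bool) : Prop :=
  exists N0 : nat, forall N, (N0 <= N)%N ->
    [/\ A N = B N, A (- 1 - N%:Z) = B (- 1 - N%:Z)
      & window_count A N = window_count B N].

Lemma eq_balanced A A' B B' : A =1 A' -> B =1 B' -> balanced A B -> balanced A' B'.
Proof.
move=> AA BB [N0 H]; exists N0 => N /H[H1 H2 H3].
by rewrite -!AA -!BB -(eq_window_count A A')// -(eq_window_count B B').
Qed.

Lemma balanced_trans A B C : balanced A B -> balanced A C -> balanced B C.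
Proof.
move=> [N0 H] [M0 K]; exists (maxn N0 M0) => N; rewrite geq_max => /andP[].
by move=> /H[<- <- <-] /K[<- <- <-].
Qed.

Lemma balanced_shift A B :
  balanced A B -> balanced (fun i => A (1 + i)) (fun i => B (1 + i)).
Proof.
(* At [N.+1] the shifted sets involve the points [N.+2], [N.+1] and [- 1 - N], so [H] is needed at
   three consecutive ranks. *)
move=> [N0 H]; exists N0.+1 => -[//|N] N0N.
have [H1 H2 H3] := H N N0N.
have [K1 K2 K3] := H N.+1 (leqW N0N).
have [L1 L2 L3] := H N.+2 (leqW (leqW N0N)).
split.
- by have -> : 1 + N.+1%:Z = N.+2 by clear; lia.
- by have -> : 1 + (- 1 - N.+1%:Z) = - 1 - N%:Z by clear; lia.
- rewrite !window_count_shift K3 K1.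
  have -> : - N.+1%:Z = - 1 - N%:Z by clear; lia.
  by rewrite H2.
Qed.

Lemma balanced_flip A B :
  balanced A B -> balanced (fun i => A (- 1 - i)) (fun i => B (- 1 - i)).
Proof.
move=> [N0 H]; exists N0 => N /H[H1 H2 H3]; split => //.
- by have -> : -1 - (-1 - N%:Z) = N by lia.
- by rewrite !window_count_flip.
Qed.

Lemma balanced_neg A B :
  balanced A B -> balanced (fun i => ~~ A i) (fun i => ~~ B i).
Proof.
by move=> [N0 H]; exists N0 => N /H[-> -> H3]; rewrite !window_count_neg H3.
Qed.

(** The unit shift and the flip $i\mapsto -1-i$ generate all isometries; conjugating by the flip
    inverts translations. *)
Lemma balanced_isom v A B : balanced A B ->
  balanced (fun i => A (line_isom v i)) (fun i => B (line_isom v i)).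
Proof.
move=> AB.
have pos (n : nat) : forall A B, balanced A B ->
    balanced (fun i => A (n%:Z + i)) (fun i => B (n%:Z + i)).
  move=> {A B AB}; elim: n => [|n IH] A B AB.
    by apply: eq_balanced AB => i; congr (_ _); lia.
  apply: eq_balanced (balanced_shift _ _ (IH _ _ AB)) => i /=;
    by congr (_ _); lia.
have trans (n : int) : forall A B, balanced A B ->
    balanced (fun i => A (n + i)) (fun i => B (n + i)).
  move=> {A B AB} A B AB; case: n => n; first exact: pos.
  apply: eq_balanced (balanced_flip _ _ (pos n.+1 _ _ (balanced_flip _ _ AB)))
    => i /=; by congr (_ _); lia.
case: v => n [|]; rewrite /line_isom /=; last exact: trans.
apply: eq_balanced (balanced_flip _ _ (trans (n + 1) _ _ AB)) => i /=;
  by congr (_ _); lia.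
Qed.

Lemma balanced_adjoin A B j k : ~~ A j -> ~~ B k -> balanced A B ->
  balanced (fun i => A i || (i == j)) (fun i => B i || (i == k)).
Proof.
move=> Aj Bk [N0 H]; exists (maxn N0 (maxn (absz j) (absz k)).+1) => N.
rewrite geq_max => /andP[/H[H1 H2 H3]]; rewrite gtn_max => /andP[jN kN].
split; last by rewrite !window_count_disjointU// H3.
- by rewrite H1; congr orb; lia.
- by rewrite H2; congr orb; lia.
Qed.

(** Raising the threshold from [m] to [m + 1] adjoins exactly one point to each set, the preimage of
    [m]; lowering it does so for the complements. *)
Lemma balanced_sublevel (f g : int -> int) :
  bijective f -> bijective g ->
  balanced (fun i => f i < 0) (fun i => g i < 0) ->
  forall m, balanced (fun i => f i < m) (fun i => g i < m).
Proof.
move=> [f' ff' f'f] [g' gg' g'g] H0.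
have up m : balanced (fun i => f i < m) (fun i => g i < m) ->
    balanced (fun i => f i < m + 1) (fun i => g i < m + 1).
  move=> H; apply: eq_balanced (balanced_adjoin _ _ (f' m) (g' m) _ _ H);
    rewrite ?f'f ?g'g ?ltxx// => i.
  - by rewrite -(inj_eq (can_inj ff')) f'f; lia.
  - by rewrite -(inj_eq (can_inj gg')) g'g; lia.
have down m : balanced (fun i => f i < m + 1) (fun i => g i < m + 1) ->
    balanced (fun i => f i < m) (fun i => g i < m).
  move=> /balanced_neg H.
  apply: eq_balanced (balanced_neg _ _
    (balanced_adjoin _ _ (f' m) (g' m) _ _ H));
    rewrite ?f'f ?g'g //; try lia; move=> i.
  - by rewrite -(inj_eq (can_inj ff')) f'f; lia.
  - by rewrite -(inj_eq (can_inj gg')) g'g; lia.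
elim/int_rect => [//|n IH|n IH].
- by rewrite intS addrC; apply: up.
- by apply: down; rewrite intS opprD addrAC addNr add0r.
Qed.

(** Composing with an isometry on the left gives another sublevel set, or the complement of one. *)
Lemma balanced_isom_comp v (f g : int -> int) :
  bijective f -> bijective g ->
  balanced (fun i => f i < 0) (fun i => g i < 0) ->
  balanced (fun i => line_isom v (f i) < 0) (fun i => line_isom v (g i) < 0).
Proof.
move=> bf bg H; have {}H := balanced_sublevel _ _ bf bg H.
case: v => n [|]; rewrite /line_isom /=.
- by apply: eq_balanced (balanced_neg _ _ (H (n + 1))) => i; lia.
- by apply: eq_balanced (H (- n)) => i; lia.
Qed.

(** The end at which the half-line lies gives the orientation; the count in a large window then
    gives the translation part. *)
Lemma balanced_isom_inj v w :
  balanced (fun i => line_isom v i < 0) (fun i => line_isom w i < 0) -> v = w.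
Proof.
have cnt u N : (`|u.1| < N)%N -> window_count (fun i => line_isom u i < 0) N =
    N%:Z - u.1 - u.2%:Z.
  case: u => n [|] /= nN; rewrite /line_isom /=.
  - rewrite (eq_window_count _ (fun i => ~~ (i < n + 1))); last by move=> i; lia.
    by rewrite window_count_neg window_count_halfline; lia.
  - rewrite (eq_window_count _ (fun i => (i < - n))); last by move=> i; lia.
    by rewrite window_count_halfline; lia.
move=> [N0 H]; pose N := (maxn N0 (maxn (absz v.1) (absz w.1)).+1).
have [|H1 _] := H N; first exact: leq_maxl.
have vN : (`|v.1| < N)%N by clear; lia.
have wN : (`|w.1| < N)%N by clear; lia.
rewrite !cnt // {cnt H}; move: H1 vN wN; rewrite /line_isom; move: N => N.
case: v w => [n [|]] [m [|]] /= H1 vN wN H2.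
- by congr pair; lia.
- by exfalso; lia.
- by exfalso; lia.
- by congr pair; lia.
Qed.

Lemma balanced_isom_exists (A : int -> bool) (L : nat) (e : bool) :
  (forall i : int, L%:Z <= i -> A i = e) ->
  (forall i : int, i < - L%:Z -> A i = ~~ e) ->
  exists w, balanced A (fun i => line_isom w i < 0).
Proof.
wlog -> : A e / e = false.
  move=> wl; case: e => Hp Hn; last exact: (wl A false erefl).
  have Hp' i : L%:Z <= i -> ~~ A i = false by move=> /Hp ->.
  have Hn' i : i < - L%:Z -> ~~ A i = ~~ false by move=> /Hn ->.
  have [w H] := wl (fun i => ~~ A i) false erefl Hp' Hn'.
  (* The reflection $i\mapsto -1-i$ exchanges negative and non-negative integers. *)
  exists (Dmul (- 1, true) w).
  apply: eq_balanced (balanced_neg _ _ H) => i; first by rewrite negbK.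
  by rewrite line_isomM {2}/line_isom /=; lia.
move=> Hp Hn.
(* Chosen so that $\{i<q\}$ has as many points in $[-L,L)$ as [A]. *)
pose q := window_count A L - L%:Z.
exists (- q, false); exists L => N LN.
rewrite Hp ?Hn /line_isom /=; [|lia..].
have := window_count_bounds A L => b.
split; [by rewrite /q; lia..|].
rewrite (eq_window_count (fun i => - q + i < 0) (fun i => i < q)); last by move=> i; lia.
rewrite window_count_halfline; last by rewrite /q; lia.
rewrite /q -(subnK LN); elim: (N - L)%N => [|k IH]; first by rewrite add0n; lia.
by rewrite addSn window_countS IH Hp ?Hn; lia.
Qed.

(** * Signs of a coarse bijection at the two ends of the line *)

(** Beyond [L] the values leave $[-M,M]$, and a step of size at most [M] cannot jump over that
    interval. *)
Lemma sign_tails (f : int -> int) (M L : nat) :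
  (forall i : int, (`|(f (i + 1) - f i)%R| <= M)%N) ->
  (forall i, (`|f i| <= M)%N -> (`|i| < L)%N) ->
  (forall i : int, L%:Z <= i -> (f i < 0) = (f L < 0)) /\
  (forall i : int, i <= - L%:Z -> (f i < 0) = (f (- L%:Z) < 0)).
Proof.
move=> step proper.
have far i : (L <= `|i|)%N -> (M < `|f i|)%N.
  by move=> Li; rewrite ltnNge; apply/negP => /proper; rewrite ltnNge Li.
split=> i iL.
- have [k ->] : exists k : nat, i = L%:Z + k%:Z.
    by exists (absz (i - L%:Z)); lia.
  elim: k {i iL} => [|k IH]; first by rewrite addr0.
  rewrite -{}IH; have := step (L%:Z + k); have := far (L%:Z + k).
  have := far (L%:Z + k.+1); have -> : L%:Z + k + 1 = L%:Z + k.+1 by lia.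
  lia.
- have [k ->] : exists k : nat, i = - L%:Z - k%:Z.
    by exists (absz (i + L%:Z)); lia.
  elim: k {i iL} => [|k IH]; first by rewrite subr0.
  rewrite -{}IH; have := step (- L%:Z - k.+1%:Z); have := far (- L%:Z - k%:Z).
  have := far (- L%:Z - k.+1%:Z).
  have -> : - L%:Z - k.+1%:Z + 1 = - L%:Z - k%:Z by lia.
  lia.
Qed.

(** With equal signs at both ends, [f] would be bounded on one side, against surjectivity. *)
Lemma sign_tails_opposite (f : int -> int) (M L : nat) : bijective f ->
  (forall i : int, (`|(f (i + 1) - f i)%R| <= M)%N) ->
  (forall i, (`|f i| <= M)%N -> (`|i| < L)%N) ->
  (f (- L%:Z) < 0) = ~~ (f L < 0).
Proof.
move=> [f' ff' f'f] step proper; have [Hp Hn] := sign_tails f M L step proper.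
have bounded (g : int -> int) : (forall i : int, (L <= `|i|)%N -> g i <= 0) ->
    exists B : nat, forall i, g i <= B.
  move=> g0; pose B := (\sum_(i < L) (`|g i| + `|g (- i%:Z)|))%N.
  exists B => i; have [/g0|iL] := leqP L `|i|%N; first by lia.
  suff : (`|g i| <= B)%N by lia.
  rewrite /B (bigD1 (Ordinal iL))//=.
  have [E|E] : i = `|i|%N \/ i = - (`|i|%N)%:Z by lia.
  - by rewrite -E; lia.
  - by rewrite -E; lia.
have tails (i : int) : (L <= `|i|)%N ->
    (f i < 0) = (f L < 0) \/ (f i < 0) = (f (- L%:Z) < 0).
  move=> Li; have [/Hp|/Hn] : L%:Z <= i \/ i <= - L%:Z by lia.
  - by left.
  - by right.
case: (boolP (f L < 0)) => fL; case: (boolP (f (- L%:Z) < 0)) => fnL //=; exfalso.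
- have [i Li|B fB] := bounded f; first by have := tails i Li; rewrite fL fnL; lia.
  by have := fB (f' (B%:Z + 1)); rewrite f'f; lia.
- have [i Li|B fB] := bounded (fun i => - f i).
    by have := tails i Li; rewrite (negPf fL) (negPf fnL); lia.
  by have := fB (f' (- B%:Z - 1)); rewrite f'f; lia.
Qed.

(** * The Cayley graph of $D_\infty$ as a line *)

(** Coordinate on the Cayley graph whose edges join [g] to [tg] and [stg]. *)
Definition line_pos (g : Dinf) : int := if g.2 then 1 - 2 * g.1 else 2 * g.1.

Definition line_elt (i : int) : Dinf :=
  if (i %% 2)%Z == 1 then (((1 - i) %/ 2)%Z, true) else ((i %/ 2)%Z, false).

(* Right multiplication by [g^-1], as an isometry of the line (see [line_pos_mulV]). *)
Definition line_act (g : Dinf) : Dinf := (g.2%:Z - 2 * g.1, g.2).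

Lemma line_posK : cancel line_pos line_elt.
Proof.
by case=> n [|]; rewrite /line_pos /line_elt /=; case: ifP => H; congr pair; lia.
Qed.

Lemma line_eltK : cancel line_elt line_pos.
Proof. by move=> i; rewrite /line_elt; case: ifP => H; rewrite /line_pos /=; lia. Qed.

Lemma line_actM g h : line_act (Dmul g h) = Dmul (line_act g) (line_act h).
Proof. by case: g h => [n [|]] [m [|]]; rewrite /line_act /Dmul /=; congr pair; lia. Qed.

Lemma line_act_inj : injective line_act.
Proof. by move=> [n e] [m e'] [/[swap] -> H]; congr pair; lia. Qed.

Lemma line_pos_mulV g h :
  line_pos (Dmul g (Dinv h)) = line_isom (line_act h) (line_pos g).
Proof. by case: g h => [n [|]] [m [|]]; rewrite /line_pos /line_isom /=; lia. Qed.

(** Right multiplication by [h] is an isometry taking the origin to the position of [h]. *)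
Lemma line_pos_dist g h : `|(line_pos (Dmul g h) - line_pos h)%R|%N = `|line_pos g|%N.
Proof. by case: g h => [n [|]] [m [|]]; rewrite /line_pos /=; lia. Qed.

Lemma line_elt_succ i : exists2 k, k = Dt \/ k = (1, true) &
  line_elt (i + 1) = Dmul k (line_elt i).
Proof.
have [H|H] := boolP ((i %% 2)%Z == 1).
  exists (1, true); first by right.
  by rewrite /line_elt H; case: ifP => H'; rewrite /Dmul /=; congr pair; lia.
exists Dt; first by left.
by rewrite /line_elt (negPf H); case: ifP => H'; rewrite /Dmul /=; congr pair; lia.
Qed.

(** * Locally constant maps on compact spaces and under minimal actions *)

Definition locally_constant {X : topologicalType} {T : Type} (c : X -> T) : Prop :=
  forall x, \forall y \near x, c y = c x.

Lemma locally_constant_comp (X : topologicalType) (T : Type) (c : X -> T) (f : X -> X) :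
  continuous f -> locally_constant c -> locally_constant (c \o f).
Proof. by move=> cf cc x; exact: cf x _ (cc (f x)). Qed.

Lemma locally_constant_bounded (X : topologicalType) (T : Type) (c : X -> T)
    (m : T -> nat) :
  compact [set: X] -> locally_constant c -> exists B, forall x, (m (c x) <= B)%N.
Proof.
move=> /compact_near_coveringP cX cc.
have [|B _ HB] := cX nat \oo (fun B x => (m (c x) <= B)%N) _.
  move=> x _; exists ([set y | c y = c x], [set B | (m (c x) <= B)%N]).
    by split; [exact: cc | exists (m (c x))].
  by move=> [y B] [/= -> ].
by exists B => x; apply: (HB B) => //=.
Qed.

(** The fibres of [c] are closed and invariant. *)
Lemma locally_constant_minimal (X : topologicalType) (T : Type)
    (alpha : Dinf -> X -> X) (c : X -> T) :
  minimal_action alpha -> locally_constant c ->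
  (forall g x, c (alpha g x) = c x) -> forall x y, c x = c y.
Proof.
move=> mina cc inv x y.
suff /seteqP[_ /(_ x)] : [set z | c z = c y] = setT by apply.
apply: mina.
- by move=> z /(_ _ (cc z))[w [/= <- <-]].
- by exists y.
- by move=> g z /= <-.
Qed.

(** * Stabilizers and topological freeness of minimal actions *)

Section DihedralAction.
Variables (X : topologicalType) (alpha : Dinf -> X -> X).
Hypothesis (alphaP : is_Dinf_action alpha).

Let act1 x : alpha Done x = x. Proof. by case: alphaP. Qed.
Let actM g h x : alpha (Dmul g h) x = alpha g (alpha h x).
Proof. by case: alphaP => _ []. Qed.
Let act_cont g : continuous (alpha g). Proof. by case: alphaP => _ []. Qed.

Lemma actK g : cancel (alpha g) (alpha (Dinv g)).
Proof. by move=> x; rewrite -actM DmulVg act1. Qed.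

Lemma actKV g : cancel (alpha (Dinv g)) (alpha g).
Proof. by move=> x; rewrite -actM DmulgV act1. Qed.

Lemma fixed_translation_mul n x (q : int) :
  alpha (n, false) x = x -> alpha (n * q, false) x = x.
Proof.
move=> nx; elim/int_rect: q => [|q IH|q IH]; first by rewrite mulr0 act1.
- by rewrite -{2}IH -{2}nx -actM; congr alpha; congr pair => /=; lia.
- by rewrite -[in LHS]nx -actM -[RHS]IH; congr alpha; congr pair => /=; lia.
Qed.

Hypotheses (hX : hausdorff_space X) (infX : ~ finite_set [set: X]).
Hypothesis (mina : minimal_action alpha).

(** Otherwise the orbit of [x] has at most $2|n|$ points; being finite it is closed, so by
    minimality it is the infinite space [X]. *)
Lemma translation_free n x : alpha (n, false) x = x -> n = 0.
Proof.
move=> nx; apply: contrapT => n0; apply: infX.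
pose orb (k : 'I_(absz n) * bool) := alpha (k.1%:Z, k.2) x.
have fin : finite_set (range orb) by apply: finite_image; exact: finite_finset.
suff <- : range orb = setT by [].
apply: mina.
- by move: fin; apply: (accessible_finite_set_closed.1 (hausdorff_accessible hX)).
- have n0' : (0 < absz n)%N by lia.
  by exists (orb (Ordinal n0', false)); exists (Ordinal n0', false).
move=> g _ [k _ <-]; rewrite /orb -actM.
move: (Dmul g _) => h.
have rn : (absz (h.1 %% n)%Z < absz n)%N by lia.
exists (Ordinal rn, h.2) => //=.
(* Divide [h.1] by [n]; the quotient changes sign when a reflection stands to the left of the
   translation. *)
rewrite -[X in alpha _ X](fixed_translation_mul n x
  (if h.2 then - (h.1 %/ n)%Z else (h.1 %/ n)%Z) nx) -actM.
congr alpha; case: h {rn} => m e; have := divz_eq m n; rewrite mulrC => Em.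
by case: e; rewrite /Dmul /= ?mulrN; congr pair; lia.
Qed.

(** Nontrivial stabilizing elements are reflections, and a product of two reflections is a
    translation, hence trivial here. *)
Lemma stabilizer_unique g h x : g <> Done -> h <> Done ->
  alpha g x = x -> alpha h x = x -> g = h.
Proof.
have refl k : k <> Done -> alpha k x = x -> k.2.
  case: k => k [//|] k1 /translation_free k0.
  by exfalso; apply: k1; rewrite k0.
move=> g1 h1 gx hx; have := refl g g1 gx; have := refl h h1 hx.
case: g h gx hx {g1 h1} => [n [|]] [m [|]] gx hx //= _ _.
have : alpha (Dmul (n, true) (m, true)) x = x by rewrite actM hx.
by move=> /translation_free /= nm; congr pair; lia.
Qed.

Hypothesis (cX : compact [set: X]).

(* If a reflection fixed an open set, then by minimality every point would be
   fixed by exactly one reflection s^n t, with n locally constant, hence bounded;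
   but the index n grows by 2 under s. *)
Lemma topologically_free g (x0 : X) : (\forall x \near x0, alpha g x = x) -> g = Done.
Proof.
case: g => m [|]; last first.
  by move=> /nbhs_singleton /translation_free ->.
move=> fix0; exfalso.
pose W := [set x : X | exists n : int, \forall y \near x, alpha (n, true) y = y].
have WT (x : X) : W x.
  apply: contrapT => nWx.
  suff /seteqP[_ /(_ x0)] : ~` W = setT by apply => //; exists m.
  apply: mina; last 2 first.
  - by exists x.
  - move=> h y nWy [n Wn]; apply: nWy.
    exists (Dmul (Dmul (Dinv h) (n, true)) h).1.
    have -> : ((Dmul (Dmul (Dinv h) (n, true)) h).1, true) =
        (Dmul (Dmul (Dinv h) (n, true)) h).
      by case: h {Wn} => k [|].
    have : nbhs y (alpha h @^-1` [set z | alpha (n, true) z = z]).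
      exact: act_cont.
    apply: filterS => z /= hz.
    by rewrite !actM hz actK.
  - move=> y cly [n /nbhs_interior Wn].
    have [z [nWz Wz]] := cly _ Wn.
    by apply: nWz; exists n.
pose n x := projT1 (cid (WT x)).
have nP x : \forall y \near x, alpha (n x, true) y = y := projT2 (cid (WT x)).
have nu k x : alpha (k, true) x = x -> k = n x.
  move=> kx; have := nbhs_singleton (nP x) => nx.
  by have [] := stabilizer_unique (k, true) (n x, true) x ltac:(by []) ltac:(by []) kx nx.
have n_lc : locally_constant n by move=> x; apply: filterS (nP x) => y /nu.
have nS k x : n (alpha (k%:Z, false) x) = n x + 2 * k%:Z.
  apply/esym/nu; rewrite -actM -[in RHS](nbhs_singleton (nP x)) -actM.
  by congr alpha; congr pair => /=; lia.
have [B nB] := locally_constant_bounded _ _ n absz cX n_lc.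
have := nB x0; have := nB (alpha (B.+1%:Z, false) x0); rewrite nS; lia.
Qed.

(** Near [x] both maps are constant, so $d(x)^{-1}c(x)$ fixes a neighbourhood pointwise. Identities
    between cocycles follow from their effect on points. *)
Lemma locally_constant_act_inj (c d : X -> Dinf) :
  locally_constant c -> locally_constant d ->
  (forall x, alpha (c x) x = alpha (d x) x) -> c =1 d.
Proof.
move=> cc cd cdx x.
suff : Dmul (Dinv (d x)) (c x) = Done.
  by move=> /(congr1 (Dmul (d x))); rewrite DmulA DmulgV Dmul1g Dmulg1.
apply: (topologically_free _ x); near=> y.
have <- : c y = c x by near: y; exact: cc.
have <- : d y = d x by near: y; exact: cd.
by rewrite actM cdx actK.
Unshelve. all: by end_near. Qed.

End DihedralAction.

(** * The orbit cocycle on the line and its approximation by isometries *)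

Lemma line_isom_bij w : bijective (line_isom w).
Proof. by exists (line_isom (Dinv w)); [exact: line_isomK | exact: line_isomKV]. Qed.

Section Cocycle.
Variables (X : topologicalType) (alpha beta : Dinf -> X -> X).
Variables (a b : Dinf -> X -> Dinf).
Hypotheses (cX : compact [set: X]) (hX : hausdorff_space X).
Hypothesis infX : ~ finite_set [set: X].
Hypotheses (alphaP : is_Dinf_action alpha) (betaP : is_Dinf_action beta).
Hypotheses (mina : minimal_action alpha) (minb : minimal_action beta).
Hypotheses (ca : continuous_cocycle a) (cb : continuous_cocycle b).
Hypothesis alphaE : forall g x, alpha g x = beta (a g x) x.
Hypothesis betaE : forall h x, beta h x = alpha (b h x) x.

Let alphaM g h x : alpha (Dmul g h) x = alpha g (alpha h x).
Proof. by case: alphaP => _ []. Qed.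
Let betaM g h x : beta (Dmul g h) x = beta g (beta h x).
Proof. by case: betaP => _ []. Qed.
Let alpha_cont g : continuous (alpha g). Proof. by case: alphaP => _ []. Qed.
Let beta_cont g : continuous (beta g). Proof. by case: betaP => _ []. Qed.
Let space_nonempty : [set: X] !=set0.
Proof. by apply/set0P/eqP => X0; apply: infX; rewrite X0. Qed.
Let beta1 x : beta Done x = x. Proof. by case: betaP. Qed.

Lemma cocycleM g h x : a (Dmul g h) x = Dmul (a g (alpha h x)) (a h x).
Proof.
move: x; apply: (locally_constant_act_inj _ _ betaP) => //.
- exact: ca.
- move=> x; have agx := locally_constant_comp _ _ _ _ (alpha_cont h) (ca g) x.
  by apply: filterS2 agx (ca h x) => y /= -> ->.
- by move=> x; rewrite betaM -!alphaE alphaM.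
Qed.

Lemma cocycleK g x : b (a g x) x = g.
Proof.
move: x; apply: (locally_constant_act_inj _ _ alphaP) => //.
- by move=> x; apply: filterS2 (ca g x) (cb (a g x) x) => y /= -> ->.
- by move=> x; apply: nearW.
- by move=> x; rewrite -betaE -alphaE.
Qed.

Lemma cocycleKV h x : a (b h x) x = h.
Proof.
move: x; apply: (locally_constant_act_inj _ _ betaP) => //.
- by move=> x; apply: filterS2 (cb h x) (ca (b h x) x) => y /= -> ->.
- by move=> x; apply: nearW.
- by move=> x; rewrite -alphaE -betaE.
Qed.

Let cocycle1 x : a Done x = Done.
Proof.
have := cocycleM Done Done x; case: alphaP => -> _; rewrite Dmul1g.
by rewrite -[LHS]Dmul1g => /Dmul_injr.
Qed.

Definition line_map (x : X) (i : int) : int := line_pos (a (line_elt i) x).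

Lemma line_map_bij x : bijective (line_map x).
Proof.
exists (fun i => line_pos (b (line_elt i) x)) => i;
  by rewrite /line_map line_posK (cocycleK, cocycleKV) line_eltK.
Qed.

(** This is $a(gh^{-1},hx)=a(g,x)\,a(h,x)^{-1}$ read on the line. *)
Lemma line_map_act h x i : line_map (alpha h x) i =
  line_isom (line_act (a h x)) (line_map x (line_isom (Dinv (line_act h)) i)).
Proof.
rewrite /line_map -line_pos_mulV; set g := line_elt (line_isom _ _).
have -> : line_elt i = Dmul g (Dinv h).
  by apply: (can_inj line_posK); rewrite line_pos_mulV !line_eltK line_isomKV.
by rewrite -{2}(DmulVK h g) [a (Dmul _ h) x]cocycleM DmulK.
Qed.

(** By the cocycle identity a step has the length of a value of [a Dt] or [a (1, true)], and
    compactness bounds both. *)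
Lemma line_map_step : exists M : nat,
  forall x i, (`|(line_map x (i + 1) - line_map x i)%R| <= M)%N.
Proof.
have [M1 H1] := locally_constant_bounded _ _ _ (absz \o line_pos) cX (ca Dt).
have [M2 H2] := locally_constant_bounded _ _ _ (absz \o line_pos) cX (ca (1, true)).
exists (maxn M1 M2) => x i; rewrite /line_map.
have [k kE ->] := line_elt_succ i; rewrite cocycleM line_pos_dist leq_max.
by case: kE => ->; [rewrite [X in X || _]H1|rewrite [X in _ || X]H2 orbT].
Qed.

(** The inverse of [line_map x] is given by [b], and compactness bounds it at each of the finitely
    many [j] with $|j|\le M$. *)
Lemma line_map_proper (M : nat) : exists L : nat,
  forall x i, (`|line_map x i| <= M)%N -> (`|i| < L)%N.
Proof.
pose B (j : int) x := `|line_pos (b (line_elt j) x)|%N.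
have bnd (j : int) : exists L : nat, forall x, (B j x < L)%N.
  have [L H] := locally_constant_bounded _ _ _ (absz \o line_pos) cX (cb (line_elt j)).
  by exists L.+1 => x; rewrite ltnS; exact: H.
suff [L H] : exists L : nat, forall x (j : int), (`|j| <= M)%N -> (B j x < L)%N.
  exists L => x i /(H x); rewrite /B /line_map line_posK cocycleK.
  by rewrite line_eltK.
elim: M => [|M [L H]].
  have [L H] := bnd 0; exists L => x j j0.
  by have -> : j = 0 by lia.
have [L1 H1] := bnd M.+1; have [L2 H2] := bnd (- M.+1%:Z).
exists (maxn L (maxn L1 L2)) => x j jM; rewrite !leq_max.
have [jM'|] := leqP `|j|%N M; first by rewrite H.
move=> Mj; have [->| ->] : j = M.+1 \/ j = - M.+1%:Z by lia.
- by rewrite H1 orbT.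
- by rewrite H2 !orbT.
Qed.

Lemma line_map_locally_constant_on (N : nat) (x : X) :
  \forall y \near x, forall i, (`|i| <= N)%N -> line_map y i = line_map x i.
Proof.
have lc (j : int) : \forall y \near x, line_map y j = line_map x j.
  by apply: filterS (ca (line_elt j) x) => y; rewrite /line_map => ->.
elim: N => [|N IH].
  by apply: filterS (lc 0) => y H i i0; have -> : i = 0 by lia.
apply: filterS3 IH (lc N.+1) (lc (- N.+1%:Z)) => y H H1 H2 i iN.
have [/H //|Ni] := leqP `|i|%N N.
by have [->| ->] : i = N.+1 \/ i = - N.+1%:Z by lia.
Qed.

(** For [y] near [x] the two line maps agree on $[-L,L]$; as [L] is uniform, their signs then agree
    everywhere, so [c y = c x] by uniqueness. *)
Lemma nearest_isom : exists c : X -> Dinf, locally_constant c /\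
  forall x, balanced (fun i => line_map x i < 0) (fun i => line_isom (c x) i < 0).
Proof.
have [M stepM] := line_map_step; have [L properL] := line_map_proper M.
have tail x := sign_tails _ _ _ (stepM x) (properL x).
have opp x := sign_tails_opposite _ _ _ (line_map_bij x) (stepM x) (properL x).
have ex x : exists w, balanced (fun i => line_map x i < 0) (fun i => line_isom w i < 0).
  apply: (balanced_isom_exists _ L (line_map x L < 0)) => i iL.
  - exact: (tail x).1.
  - by rewrite (tail x).2 ?opp// ltW.
pose c x := projT1 (cid (ex x)).
have cP x : balanced (fun i => line_map x i < 0) (fun i => line_isom (c x) i < 0) :=
  projT2 (cid (ex x)).
exists c; split => // x.
apply: filterS (line_map_locally_constant_on L x) => y yx.
apply: balanced_isom_inj; apply: balanced_trans (cP y) _.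
apply: eq_balanced (cP x) => // i; rewrite /=.
have [iL|iL] := leqP `|i|%N L; first by rewrite yx.
have [Hp Hn] := tail x; have [Hp' Hn'] := tail y.
have [i0|i0] : L%:Z <= i \/ i <= - L%:Z by lia.
- by rewrite Hp ?Hp'// yx//; lia.
- by rewrite Hn ?Hn'// yx//; lia.
Qed.

(* [c] is the closest-isometry map; its equivariance exhibits the cocycle [a],
   read in the index-two overgroup of all isometries of the line, as a coboundary. *)
Lemma nearest_isom_equivariant (c : X -> Dinf) :
  (forall x, balanced (fun i => line_map x i < 0) (fun i => line_isom (c x) i < 0)) ->
  forall h x, Dmul (c (alpha h x)) (line_act h) = Dmul (line_act (a h x)) (c x).
Proof.
move=> cP h x.
suff -> : c (alpha h x) =
    Dmul (Dmul (line_act (a h x)) (c x)) (Dinv (line_act h)) by rewrite DmulVK.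
apply: balanced_isom_inj; apply: balanced_trans (cP _) _.
have := balanced_isom_comp (line_act (a h x)) _ _ (line_map_bij x)
  (line_isom_bij (c x)) (cP x).
move=> /(balanced_isom (Dinv (line_act h))); apply: eq_balanced => i.
- by rewrite line_map_act.
- by rewrite !line_isomM.
Qed.

Lemma cocycle_coboundary : exists (d : X -> Dinf) (tau : Dinf -> Dinf),
  [/\ locally_constant d, is_Dinf_aut tau &
      forall h x, Dmul (d (alpha h x)) (tau h) = Dmul (a h x) (d x)].
Proof.
have [c [c_lc cP]] := nearest_isom; have cE := nearest_isom_equivariant c cP.
have [x0 _] := space_nonempty.
(* The image of [line_act], of index two, consists of the [w] with [w.1] of the parity of [w.2];
   [p x] says that [c x] lies outside it. *)
pose p x := ((c x).1 %% 2)%Z == ~~ (c x).2.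
have pE x : p x = p x0.
  apply: (locally_constant_minimal _ _ alpha) => //.
    by move=> y; apply: filterS (c_lc y) => z; rewrite /p => ->.
  move=> g y; have := cE g y; rewrite /p.
  case: (c (alpha g y)) => n e; case: (c y) => n' e'; case: (a g y) => m k.
  case: g => m' k'; rewrite /Dmul /line_act.
  by case: e; case: e'; case: k; case: k' => //= -[]; lia.
(* [eta] represents the constant coset, [d_of w] solves [w = Dmul (line_act d) eta] for [d], and
   [tau] is conjugation by [eta]. *)
pose eta : Dinf := ((p x0)%:Z, false).
pose d_of (w : Dinf) : Dinf :=
  (((w.2%:Z - w.1 + (if w.2 then - (p x0)%:Z else (p x0)%:Z)) %/ 2)%Z, w.2).
pose tau (h : Dinf) : Dinf := (h.1 - (if h.2 then (p x0)%:Z else 0), h.2).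
have dE x : c x = Dmul (line_act (d_of (c x))) eta.
  have : (((c x).1 %% 2)%Z == ~~ (c x).2) = p x0 by exact: pE.
  rewrite /d_of /eta; move: (p x0) => q.
  by case: (c x) => n [|]; case: q; rewrite /Dmul /line_act /= => H; congr pair; lia.
have tauE h : Dmul eta (line_act h) = Dmul (line_act (tau h)) eta.
  rewrite /eta /tau; move: (p x0) => q.
  by case: h => n [|]; rewrite /Dmul /line_act /=; congr pair; lia.
exists (d_of \o c), tau; split.
- by move=> x; apply: filterS (c_lc x) => y /= ->.
- rewrite /tau; move: (p x0) => q; split.
    exists (fun h => (h.1 + (if h.2 then q%:Z else 0), h.2)) => -[n [|]] /=;
    by congr pair; lia.
  by case=> [n [|]] [m [|]]; rewrite /Dmul /=; congr pair; lia.
move=> h x; apply: line_act_inj; rewrite !line_actM /comp.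
apply: (Dmul_injr _ eta).
by rewrite -!DmulA -tauE -dE DmulA -dE cE.
Qed.

(** * From the coboundary to a conjugacy *)

Lemma conjugate_of_cocycle : conjugate_actions alpha beta.
Proof.
have [d [tau [d_lc [tau_bij tauM] dE]]] := cocycle_coboundary.
pose phi x := beta (Dinv (d x)) x.
have phiE g x : phi (alpha g x) = beta (tau g) (phi x).
  rewrite /phi [in X in beta _ X]alphaE -!betaM; congr beta.
  apply: (Dmul_injr _ (d x)); rewrite -!DmulA DmulVg -dE DmulKV.
  by rewrite Dmulg1.
have phi_cont : continuous phi.
  move=> x; apply: (cvg_trans _ (beta_cont (Dinv (d x)) x)).
  apply: near_eq_cvg; apply: filterS (d_lc x) => y dy.
  by rewrite /phi dy.
have [taui tauK tauKV] := tau_bij.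
have tau1 : tau Done = Done.
  have := tauM Done Done; rewrite Dmul1g.
  by rewrite -[LHS]Dmul1g => /Dmul_injr.
have tau_inj := can_inj tauK.
have phi_inj : injective phi.
  move=> x y xy.
  have [g yE] : exists g, y = alpha g x.
    exists (b (Dmul (d y) (Dinv (d x))) x).
    by rewrite -betaE betaM -[beta _ x]/(phi x) xy actKV.
  have gx : beta (tau g) (phi x) = phi x by rewrite -phiE -yE.
  have [g1|g1] := pselect (g = Done).
    by rewrite yE g1; case: alphaP => ->.
  (* [k] fixes [x] under [beta], so [b k x] fixes it under [alpha]. Both [tau g] and [tau (b k x)]
     are nontrivial and fix [phi x], hence coincide. *)
  pose k := Dmul (d x) (Dmul (tau g) (Dinv (d x))).
  have kx : beta k x = x by rewrite /k !betaM -[beta _ x]/(phi x) gx actKV.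
  have g0x : alpha (b k x) x = x by rewrite -betaE.
  suff gE : g = b k x by rewrite yE gE.
  apply: (tau_inj).
  apply: (stabilizer_unique X beta betaP hX infX minb _ _ (phi x)) => //.
  - by rewrite -tau1 => /tau_inj.
  - rewrite -tau1 => /tau_inj bk; apply: g1; apply: (tau_inj); rewrite tau1.
    have : k = Done by rewrite -(cocycleKV k x) bk cocycle1.
    rewrite /k => /(congr1 (fun u => Dmul (Dinv (d x)) (Dmul u (d x)))).
    by rewrite -DmulA DmulKV DmulVK Dmul1g DmulVg.
  - by rewrite -phiE g0x.
have phi_surj : range phi = setT.
  (* The image is closed by compactness, and invariant because [tau] is onto. *)
  apply: minb.
  - apply: compact_closed => //; apply: continuous_compact => //.
    exact: continuous_subspaceT.
  - by have [x0 _] := space_nonempty; exists (phi x0); exists x0.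
  - by move=> g _ [x _ <-]; exists (alpha (taui g) x) => //; rewrite phiE tauKV.
have ex y : exists x, phi x = y.
  by have /seteqP[_ /(_ y I)[x _ <-]] := phi_surj; exists x.
pose psi y := projT1 (cid (ex y)).
have psiK : cancel psi phi := fun y => projT2 (cid (ex y)).
have phiK : cancel phi psi by move=> x; apply: phi_inj; rewrite psiK.
exists phi, psi, tau; split; last by split.
split => //; split => //; apply/continuous_closedP => C clC.
have -> : psi @^-1` C = phi @` C.
  apply/seteqP; split => [y Cy|_ [x Cx <-]]; last by rewrite /= phiK.
  by exists (psi y).
apply: compact_closed => //; apply: continuous_compact.
  exact: continuous_subspaceT.
by apply: subclosed_compact clC cX _.
Qed.

End Cocycle.

(** * Reduction to an orbit equivalence through the identity map *)

Theorem theorem1p2 (X : topologicalType) (alpha beta : Dinf -> X -> X) :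
  compact [set: X] -> hausdorff_space X -> ~ finite_set [set: X] ->
  is_Dinf_action alpha -> is_Dinf_action beta ->
  minimal_action alpha -> minimal_action beta ->
  cont_orbit_equivalent alpha beta ->
  conjugate_actions alpha beta.
Proof.
move=> cX hX infX alphaP [beta1 [betaM beta_cont]] mina minb.
move=> [phi [psi [a [b [[phi_cont [psi_cont [phiK psiK]]] [ca [cb [aE bE]]]]]]]].
(* Transporting [beta] along [phi] gives an action with the same orbits as [alpha]; [a] stays its
   cocycle and [b] is precomposed with [phi]. *)
pose beta' g := psi \o (beta g \o phi).
have beta'_cont g : continuous (beta' g).
  move=> x; apply: continuous_comp; last exact: psi_cont.
  by apply: continuous_comp; [exact: phi_cont|exact: beta_cont].
have beta'P : is_Dinf_action beta'.
  split; first by move=> x; rewrite /beta' /= beta1 phiK.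
  by split => // g h x; rewrite /beta' /= betaM psiK.
have minb' : minimal_action beta'.
  move=> A clA [x Ax] invA.
  have /seteqP[_ AT] : psi @^-1` A = setT.
    apply: minb.
    - by move/continuous_closedP: psi_cont; apply.
    - by exists (phi x); rewrite /= phiK.
    - by move=> g y Ay; have := invA g _ Ay; rewrite /beta' /= psiK.
  by apply/seteqP; split => // y _; rewrite -(phiK y); exact: AT.
have [f [f' [tau [[f_cont [f'_cont [fK f'K]]] [tauP fE]]]]] :
    conjugate_actions alpha beta'.
  apply: (conjugate_of_cocycle X alpha beta' a (fun h x => b h (phi x))) => //.
  - by move=> h; exact: locally_constant_comp phi_cont (cb h).
  - by move=> g x; rewrite /beta' /= -aE phiK.
  - by move=> h x; rewrite /beta' /= bE phiK.
exists (phi \o f), (f' \o psi), tau; split; last first.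
  by split => // g x; rewrite /= fE /beta' /= psiK.
split; first by move=> x; apply: continuous_comp; [exact: f_cont|exact: phi_cont].
split; first by move=> x; apply: continuous_comp; [exact: psi_cont|exact: f'_cont].
by split=> x /=; rewrite ?phiK ?fK ?f'K ?psiK.
Qed.
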